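(* Let $\{G_n\}_{n\ge1}$ be a sequence of graphs with finite diameters satisfying $\mathrm{diam}(G_n)=\omega(1)$, and let $\{r_n\}_{n\ge1}$ be positive integers with $r_n=\varepsilon\cdot\mathrm{diam}(G_n)$. Then $$\lambda_2\big(G_n^{(r_n)}\big)\ge (1-o_\varepsilon(1))\,(r_n+1)\,\hat d_{r_n}(G_n)^{\,r_n/2},$$ where $\hat d_r(G)=\Big(\frac{1}{r+1}\sum_{i=0}^{r}\sqrt{\delta^{(i)}(G)\,\delta^{(r-i)}(G)}\Big)^{2/r}$ and $\delta^{(i)}(G)=\min_{(x,y)\in E(G)}\big|\{v\in V(G): d_G(x,v)=i,\ d_G(y,v)\ge i\}\big|$.
   Context: For a graph $G$ and integer $r\ge1$, $G^{(r)}$ is the graph on $V(G)$ in which two vertices are adjacent iff they are at distance $\le r$ in $G$; its adjacency matrix $A^{(r)}$ has $A^{(r)}_{ij}=1$ iff $d_G(i,j)\le r$ (diagonal entries $1$), and $\lambda_2(G^{(r)})$ denotes the second largest eigenvalue of $A^{(r)}$. The minimum defining $\delta^{(i)}$ is over ordered pairs $(x,y)$ of adjacent vertices. $o_\varepsilon(1)$ denotes a quantity tending to $0$ as $\varepsilon\to0$. *)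

(* Defs.v *)
From HB Require Import structures.
From mathcomp Require Import all_boot all_order all_algebra.
From mathcomp Require Import reals exp.
Set Implicit Arguments. Unset Strict Implicit. Unset Printing Implicit Defensive.
Import Order.TTheory GRing.Theory Num.Theory.
Local Open Scope ring_scope.

Definition simple_graph (T : finType) (adj : rel T) : Prop :=
  (forall x y, adj x y = adj y x) /\ (forall x, ~~ adj x x).

Fixpoint ball (T : finType) (adj : rel T) (k : nat) (x : T) : {set T} :=
  match k with
  | 0 => [set x]
  | k'.+1 => ball adj k' x :|: [set v | [exists u in ball adj k' x, adj u v]]
  end.

Definition connected_graph (T : finType) (adj : rel T) : Prop :=
  forall x y : T, exists k, y \in ball adj k x.

(* graph distance d_G(x,y): least k with y in the k-ball of x (for connected
   graphs every such distance is < #|T|; the value #|T| is a sentinel for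
   unreachable vertices, which never occurs for connected graphs). *)
Definition dist (T : finType) (adj : rel T) (x y : T) : nat :=
  find (fun k => y \in ball adj k x) (iota 0 #|T|).

Definition diam (T : finType) (adj : rel T) : nat :=
  \max_(x : T) \max_(y : T) dist adj x y.

(* delta^{(i)}(G) = min over ordered adjacent pairs (x,y) of
   |{v : d(x,v) = i, d(y,v) >= i}|  (default #|T| if there are no edges) *)
Definition delta_i (T : finType) (adj : rel T) (i : nat) : nat :=
  \big[minn/#|T|]_(p : T * T | adj p.1 p.2)
     #|[set v | (dist adj p.1 v == i) && (i <= dist adj p.2 v)%N]|.

Definition hat_d (R : realType) (T : finType) (adj : rel T) (r : nat) : R :=
  powR ((r.+1)%:R^-1 *
        \sum_(0 <= i < r.+1)
           Num.sqrt ((delta_i adj i)%:R * (delta_i adj (r - i))%:R))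
       (2 / r%:R).

(* adjacency matrix of G^{(r)}: entry 1 iff d_G(i,j) <= r (diagonal 1) *)
Definition distpow_mx (R : realType) (T : finType) (adj : rel T) (r : nat)
  : 'M[R]_#|T| :=
  \matrix_(i, j) (dist adj (enum_val i) (enum_val j) <= r)%N%:R.

Definition is_lambda2 (R : realType) (n : nat) (A : 'M[R]_n) (l : R) : Prop :=
  exists s : seq R,
    [/\ size s = n, sorted (fun a b => b <= a) s,
        char_poly A = \prod_(x <- s) ('X - x%:P) & l = nth 0 s 1].

(* Main.v *)
Require Import Defs.
From HB Require Import structures.
From mathcomp Require Import all_boot all_order all_algebra.
From mathcomp Require Import boolp reals exp complex sesquilinear spectral.
From mathcomp Require Import ring lra zify.
Import Order.TTheory GRing.Theory Num.Theory.
Local Open Scope ring_scope.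

Set Implicit Arguments.
Unset Strict Implicit.
Unset Printing Implicit Defensive.

(** Write A for the matrix of G^(r), delta_i for delta^(i), and S for the sum of
    the sqrt (delta_i delta_(r-i)), so that the claim reads
    lambda_2 >= (1 - o(1)) S; we prove it with error 20 eps.

    Suppose that c exceeds every Rayleigh quotient of A on functions supported
    in a ball around o.  The compression of c - A to the ball is then positive
    definite with nonpositive off-diagonal entries, so its inverse is
    nonnegative, and this yields G > 0 on the ball with A G <= c G.  Let phi_j
    be the minimum of G over B(o, r+1+j), attained at v, and walk from v towards
    o along x_0 = v, x_1, ...  The sets {u : d(x_i,u) = r-i, d(x_(i+1),u) >= r-i}
    are disjoint, lie in B(v,r), have at least delta_(r-i) elements, and reach
    at most r-2i levels above v; hence
      sum_i delta_(r-i) phi_(j+r-2i) <= c phi_j.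
    Sum the ratios delta_(r-i) phi_(j+r-2i) / phi_j over M + r levels and apply
    AM-GM to the step r-2i from one level and the opposite step back to it: the
    values of phi cancel, and M S <= (M + r) c.

    So any ball of radius 2r + M carries a function whose Rayleigh quotient is
    essentially at least M S / (M + r).  Two such balls at distance more than r
    do not interact under A, and lambda_2 is at least this quotient. *)

Lemma form_sum (F : fieldType) (theta : {rmorphism F -> F}) n (M : 'M[F]_n)
    (u v : 'rV_n) :
  form theta M u v = \sum_j (u *m M) 0 j * theta (v 0 j).
Proof. by rewrite /form mxE; apply: eq_bigr => j _; rewrite !mxE. Qed.

Lemma form_eq0 (F : fieldType) (theta : {rmorphism F -> F}) n (M : 'M[F]_n)
    (u v : 'rV_n) :
  (forall i j, u 0 i != 0 -> v 0 j != 0 -> M i j = 0) -> form theta M u v = 0.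
Proof.
move=> M0; rewrite form_sum big1 // => j _.
have [->|vj0] := eqVneq (v 0 j) 0; first by rewrite rmorph0 mulr0.
rewrite mxE big1 ?mul0r // => i _.
by have [->|ui0] := eqVneq (u 0 i) 0; rewrite ?mul0r // M0 ?mulr0.
Qed.

Lemma form_sym (F : fieldType) n (M : 'M[F]_n) (u v : 'rV_n) :
  M^T = M -> form idfun M u v = form idfun M v u.
Proof.
move=> symM; rewrite (@formC _ _ false) ?mul1r //.
by apply/sesquiP; rewrite expr0 scale1r map_mx_id // symM.
Qed.

Lemma form1_sqr (F : fieldType) n (u : 'rV[F]_n) :
  form idfun 1%:M u u = \sum_j u 0 j ^+ 2.
Proof. by rewrite form_sum mulmx1; apply: eq_bigr => j _; rewrite expr2. Qed.

Lemma form1_gt0 (F : realFieldType) n (u : 'rV[F]_n) : u != 0 -> 0 < form idfun 1%:M u u.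
Proof.
case/rV0Pn=> j uj0; rewrite form1_sqr (bigD1 j) //= ltr_wpDr ?exprn_even_gt0 //.
by rewrite sumr_ge0 // => i _; rewrite sqr_ge0.
Qed.

Definition rayleigh_ge (F : realFieldType) n (M : 'M[F]_n) (c : F) (f : 'rV_n) : bool :=
  (f != 0) && (c * form idfun 1%:M f f <= form idfun M f f).

Lemma form_unitary_diag (C : numClosedFieldType) n (P : 'M[C]_n) (d z : 'rV_n) :
  P \is unitarymx ->
  form Num.conj (invmx P *m diag_mx d *m P) z z
    = \sum_i d 0 i * `|(z *m invmx P) 0 i| ^+ 2.
Proof.
move=> uP; have PE : P = map_mx Num.conj (invmx P)^T by rewrite invmx_unitary // trmxCK.
set Q := invmx P in PE *; rewrite /form PE.
rewrite -!mulmxA -map_mxM -trmx_mul !mulmxA mxE; apply: eq_bigr => i _.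
by rewrite mul_mx_diag !mxE normCK mulrA [d 0 i * _]mulrC.
Qed.

Lemma char_poly_similar (R : comUnitRingType) n (P D : 'M[R]_n) :
  P \in unitmx -> char_poly (invmx P *m D *m P) = char_poly D.
Proof.
move=> uP; pose Q := map_mx (@polyC R) P; pose Q' := map_mx (@polyC R) (invmx P).
have Q'Q : Q' *m Q = 1%:M by rewrite -map_mxM mulVmx // map_mx1.
have -> : char_poly (invmx P *m D *m P) = \det (Q' *m char_poly_mx D *m Q).
  rewrite /char_poly /char_poly_mx !map_mxM mulmxBr mulmxBl -/Q -/Q'.
  by rewrite scalar_mxC -[_ *m Q' *m Q]mulmxA Q'Q mulmx1.
by rewrite !det_mulmx mulrAC -det_mulmx Q'Q det1 mul1r.
Qed.

Lemma exists_scalar_relation (F : fieldType) (u v : F) :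
  exists a b : F, ((a != 0) || (b != 0)) /\ a * u + b * v = 0.
Proof.
have [->|u0] := eqVneq u 0; first by exists 1, 0; rewrite oner_eq0 mulr0 mul0r addr0.
by exists v, (- u); rewrite oppr_eq0 u0 orbT mulrC mulNr subrr.
Qed.

Lemma count_gt_second (R : realDomainType) (s : seq R) :
  sorted (fun a b => b <= a) s -> (count (> nth 0 s 1)%R s <= 1)%N.
Proof.
case: s => [//|a [|b s]] /=; first by rewrite addn0 leq_b1.
rewrite (path_sortedE (rev_trans le_trans)) => /and3P[_ /allP s_le _].
rewrite ltxx add0n (eq_in_count (a2 := pred0)) ?count_pred0 ?addn0 ?leq_b1 //.
by move=> x /s_le; rewrite /= leNgt => /negPf.
Qed.

Section ComplexForms.
Variable R : rcfType.
Local Notation toC := (real_complex R).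

Lemma form_real_complex n (M : 'M[R]_n) (u v : 'rV_n) :
  form Num.conj (map_mx toC M) (map_mx toC u) (map_mx toC v) = toC (form idfun M u v).
Proof.
rewrite !form_sum rmorph_sum; apply: eq_bigr => j _.
rewrite -map_mxM !mxE rmorphM; congr (_ * _).
by apply/CrealP/complex_realP; exists (v 0 j).
Qed.

Lemma form_real_comb n (M : 'M[R]_n) (f g : 'rV_n) (a b : R[i])
    (z := a *: map_mx toC f + b *: map_mx toC g) :
  M^T = M -> form idfun M f g = 0 ->
  form Num.conj (map_mx toC M) z z
    = `|a| ^+ 2 * toC (form idfun M f f) + `|b| ^+ 2 * toC (form idfun M g g).
Proof.
move=> symM fg0; rewrite /z formDl !formDr !(formZl, formZr) !form_real_complex.
by rewrite (form_sym g f symM) fg0 rmorph0 !mulr0 addr0 add0r !mulrA -!normCK.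
Qed.

Lemma symmetric_spectral n (A : 'M[R]_n) (s : seq R) :
  A^T = A -> char_poly A = \prod_(x <- s) ('X - x%:P) ->
  exists (P : 'M[R[i]]_n) (d : 'rV[R]_n),
    [/\ P \is unitarymx, map_mx toC A = invmx P *m diag_mx (map_mx toC d) *m P
      & perm_eq [seq d 0 i | i <- enum 'I_n] s].
Proof.
move=> symA cpA; set AC := map_mx toC A.
have nAC : AC \is normalmx.
  apply: symmetric_normalmx.
    by apply/is_hermitianmxP; rewrite expr0 scale1r map_mx_id // /AC map_trmx symA.
  by apply/mxOverP=> i j; rewrite mxE; apply/complex_realP; exists (A i j).
have ACE := orthomx_spectralP nAC; set P := spectralmx AC in ACE.
set D := spectral_diag AC in ACE.
have roots_perm : perm_eq [seq D 0 i | i <- enum 'I_n] (map toC s).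
  apply: prod_XsubC_eq; transitivity (char_poly AC).
    rewrite ACE char_poly_similar ?spectral_unit // char_poly_trig ?diag_mx_is_trig //.
    by rewrite big_map big_enum; apply: eq_bigr => i _; rewrite mxE eqxx mulr1n.
  rewrite -map_char_poly cpA rmorph_prod big_map; apply: eq_bigr => x _ /=.
  by rewrite rmorphB /= map_polyX map_polyC.
have DE : D = map_mx toC (map_mx (@complex.Re R) D).
  apply/rowP=> i; rewrite !mxE.
  have : D 0 i \in map toC s by rewrite -(perm_mem roots_perm) map_f // mem_enum.
  by case/mapP=> x _ ->.
exists P, (map_mx (@complex.Re R) D); split; rewrite ?spectral_unitarymx -?DE //.
have -> : [seq (map_mx (@complex.Re R) D) 0 i | i <- enum 'I_n]
    = map (@complex.Re R) [seq D 0 i | i <- enum 'I_n].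
  by rewrite -[RHS]map_comp; apply: eq_map => i; rewrite mxE.
have := perm_map (@complex.Re R) roots_perm.
by rewrite -[X in perm_eq _ X]map_comp [X in perm_eq _ X]map_id.
Qed.

End ComplexForms.

Section SecondEigenvalue.
Variable R : realType.
Local Notation toC := (real_complex R).

(* The upper half of Courant-Fischer: [p] is the top eigenvector, if its
   eigenvalue exceeds [l]. *)
Lemma lambda2_form_le n (A : 'M[R]_n) (l : R) :
  A^T = A -> is_lambda2 A l ->
  exists p : 'cV[R[i]]_n, forall z : 'rV_n, z *m p = 0 ->
    form Num.conj (map_mx toC A) z z <= toC l * form Num.conj 1%:M z z.
Proof.
move=> symA [s [_ sorted_s cpA ->]]; set l2 := nth 0 s 1.
have [P [d [uniP AE perm_ds]]] := symmetric_spectral symA cpA.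
have /card_le1_eqP top_eq : (#|[pred i | (l2 < d 0 i)%R]| <= 1)%N.
  have := count_gt_second sorted_s; rewrite -(permP perm_ds) count_map.
  by rewrite cardE size_filter -enumT.
pose top := [pick i | l2 < d 0 i].
exists (if top is Some i then col i (invmx P) else 0) => z zp0.
pose w := z *m invmx P.
have w_top i : l2 < d 0 i -> w 0 i = 0.
  move=> di; move: zp0; rewrite /top; case: pickP => [j dj|/(_ i)]; last by rewrite di.
  rewrite (top_eq j i) // => /matrixP/(_ 0 0); rewrite !mxE => {2}<-.
  by apply: eq_bigr => k _; rewrite mxE.
have normE : form Num.conj 1%:M z z = \sum_i `|w 0 i| ^+ 2.
  rewrite -(mulVmx (unitarymx_unit uniP)) -[X in X *m P]mulmx1.
  rewrite -diag_const_mx form_unitary_diag //.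
  by apply: eq_bigr => i _; rewrite mxE mul1r.
rewrite normE AE form_unitary_diag // mulr_sumr.
apply: ler_sum => i _; have [di|di] := ltP l2 (d 0 i).
  by rewrite -/w w_top // normr0 expr0n !mulr0.
by rewrite ler_wpM2r ?exprn_ge0 // mxE lecR.
Qed.

Lemma lambda2_ge_orthogonal_pair n (A : 'M[R]_n) (l c : R) (f g : 'rV_n) :
  A^T = A -> is_lambda2 A l ->
  form idfun 1%:M f g = 0 -> form idfun A f g = 0 ->
  rayleigh_ge A c f -> rayleigh_ge A c g -> c <= l.
Proof.
move=> symA lA fg0 fAg0 /andP[f0 fAf] /andP[g0 gAg].
have [p ple] := lambda2_form_le symA lA.
have [a [b [ab0 abp]]] :=
  exists_scalar_relation ((map_mx toC f *m p) 0 0) ((map_mx toC g *m p) 0 0).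
pose z := a *: map_mx toC f + b *: map_mx toC g.
have zp0 : z *m p = 0.
  apply/matrixP=> i j; rewrite !ord1 mulmxDl -!scalemxAl 2!mxE [X in _ + X]mxE.
  by rewrite abp mxE.
have zE M := @form_real_comb _ n M f g a b.
have z_gt0 : 0 < form Num.conj (map_mx toC 1%:M) z z.
  have term_ge0 (s : R[i]) h : h != 0 -> 0 <= `|s| ^+ 2 * toC (form idfun 1%:M h h).
    by move=> h0; rewrite mulr_ge0 ?exprn_ge0 // lecR ltW ?form1_gt0.
  have term_gt0 (s : R[i]) h :
      s != 0 -> h != 0 -> 0 < `|s| ^+ 2 * toC (form idfun 1%:M h h).
    by move=> s0 h0; rewrite mulr_gt0 ?exprn_gt0 ?normr_gt0 // ltcR form1_gt0.
  rewrite zE ?trmx1 //; case/orP: ab0 => [a0|b0].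
    by rewrite ltr_wpDr ?term_ge0 ?term_gt0.
  by rewrite ltr_wpDl ?term_ge0 ?term_gt0.
rewrite -lecR -(ler_pM2r z_gt0) map_mx1; apply: le_trans (ple z zp0).
rewrite -(map_mx1 toC) !zE ?trmx1 // mulrDr.
by apply: lerD; rewrite mulrCA ler_wpM2l ?exprn_ge0 // -rmorphM lecR.
Qed.

Lemma lambda2_ge0 n (A : 'M[R]_n) (l : R) (i j : 'I_n) :
  A^T = A -> is_lambda2 A l -> i != j -> A i i = A j j -> `|A i j| <= A i i ->
  0 <= l.
Proof.
move=> symA lA ij Aij; rewrite ler_norml => /andP[Alo Ahi].
have Aji : A j i = A i j by rewrite -[in RHS]symA mxE.
have ji : (j == i) = false by rewrite eq_sym (negPf ij).
have pm_neq0 (b : R) : delta_mx 0 i + b *: delta_mx 0 j != 0 :> 'rV_n.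
  apply/eqP => /rowP/(_ i)/eqP; rewrite !mxE !eqxx (negPf ij) mulr0 addr0.
  by rewrite oner_eq0.
have formE M (a b : R) :
    form idfun M (delta_mx 0 i + a *: delta_mx 0 j) (delta_mx 0 i + b *: delta_mx 0 j)
      = M i i + b * M i j + a * (M j i + b * M j j).
  by rewrite formDl !formDr !(formZl, formZr) !formee /= mulrDr.
apply: (lambda2_ge_orthogonal_pair (f := delta_mx 0 i + 1 *: delta_mx 0 j)
  (g := delta_mx 0 i + -1 *: delta_mx 0 j) symA lA); rewrite /rayleigh_ge ?pm_neq0 /=;
  rewrite !formE ?mxE ?eqxx ?ji ?(negPf ij) ?Aji -?Aij; lra.
Qed.

End SecondEigenvalue.

Section PositiveSupersolution.
Variable R : realFieldType.

Definition posdefmx n (N : 'M[R]_n) : Prop :=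
  forall f : 'rV_n, f != 0 -> 0 < form idfun N f f.

Lemma posdefmx_unit n (N : 'M[R]_n) : posdefmx N -> N \in unitmx.
Proof.
move=> posN; rewrite -row_free_unit; apply: inj_row_free => f fN0.
apply/eqP; apply: contraT => /posN.
by rewrite /form fN0 mul0mx mxE ltxx.
Qed.

Lemma posdefmx_inverse_ge0 n (N : 'M[R]_n) (e : 'rV_n) :
  (forall i j, i != j -> N i j <= 0) -> posdefmx N -> (forall j, 0 <= e 0 j) ->
  forall j, 0 <= (e *m invmx N) 0 j.
Proof.
move=> offN posN e0; set u := e *m invmx N.
have uN : u *m N = e by rewrite mulmxKV ?posdefmx_unit.
move: u uN => u uN.
pose v := map_mx (fun x => Num.max (- x) 0) u; pose w := map_mx (fun x => Num.max x 0) u.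
have uE : u = w - v.
  by apply/rowP=> j; rewrite !mxE oppr_max opprK oppr0 addr_max_min addr0.
have uv_ge0 : 0 <= form idfun N u v.
  rewrite form_sum uN sumr_ge0 // => j _.
  by rewrite mulr_ge0 // mxE le_max lexx orbT.
have wv_le0 : form idfun N w v <= 0.
  rewrite form_sum sumr_le0 //= => j _; rewrite mxE mulr_suml sumr_le0 // => i _.
  have v_ge0 k : 0 <= v 0 k by rewrite mxE le_max lexx orbT.
  have w_ge0 k : 0 <= w 0 k by rewrite mxE le_max lexx orbT.
  have [->|ij] := eqVneq i j; last first.
    by rewrite mulr_le0_ge0 ?mulr_ge0_le0 ?offN ?v_ge0 ?w_ge0.
  suff wv0 : w 0 j * v 0 j = 0 by rewrite mulrAC wv0 mul0r.
  have [u0|/ltW u0] := leP 0 (u 0 j); rewrite !mxE.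
    by rewrite [X in _ * X]max_r ?oppr_le0 // mulr0.
  by rewrite max_r // mul0r.
have v0 : v = 0.
  apply/eqP; apply: contraT => /posN; rewrite ltNge.
  by rewrite (le_trans _ wv_le0) // -subr_ge0 -formNl -formDl -uE.
by move=> j; rewrite uE v0 subr0 mxE le_max lexx orbT.
Qed.

Lemma positive_supersolution n (M : 'M[R]_n) (P : pred 'I_n) (c : R) :
  0 < c -> (forall i j, 0 <= M i j) ->
  (forall f : 'rV_n, (forall j, f 0 j != 0 -> P j) -> ~~ rayleigh_ge M c f) ->
  exists u : 'rV_n, [/\ forall j, 0 <= u 0 j, forall j, P j -> 0 < u 0 j
    & forall j, P j -> (u *m M) 0 j <= c * u 0 j].
Proof.
move=> c0 M0 noray; pose D : 'M[R]_n := diag_mx (\row_j (P j)%:R).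
pose N := c%:M - D *m M *m D.
have fDE (f : 'rV_n) j : (f *m D) 0 j = f 0 j * (P j)%:R by rewrite mul_mx_diag !mxE.
have formN (f : 'rV_n) :
    form idfun N f f = c * form idfun 1%:M f f - form idfun M (f *m D) (f *m D).
  rewrite /form trmx_mul tr_diag_mx !map_mx_id // mulmxBr mulmxBl mul_mx_scalar mulmx1.
  by rewrite -scalemxAl !mulmxA [LHS]mxE [X in X + _]mxE [X in _ + X]mxE.
have posN : posdefmx N.
  move=> f f0; rewrite formN subr_gt0; have [->|fD0] := eqVneq (f *m D) 0.
    by rewrite form0l mulr_gt0 ?form1_gt0.
  have : ~~ rayleigh_ge M c (f *m D).
    by apply: noray => j; rewrite fDE; case: (P j); rewrite ?mulr0 ?eqxx.
  rewrite /rayleigh_ge fD0 -ltNge => /lt_le_trans; apply.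
  rewrite ler_pM2l // !form1_sqr ler_sum // => j _; rewrite fDE.
  by case: (P j); rewrite ?mulr1 // mulr0 expr0n sqr_ge0.
have offN i j : i != j -> N i j <= 0.
  move=> /negPf ij; rewrite /N mul_mx_diag mul_diag_mx !mxE ij sub0r oppr_le0.
  by rewrite !mulr_ge0.
pose u : 'rV_n := const_mx 1 *m invmx N.
have uN : u *m N = const_mx 1 by rewrite mulmxKV ?posdefmx_unit.
have u0 : forall j, 0 <= u 0 j by apply: posdefmx_inverse_ge0 => // j; rewrite mxE.
have uE j : P j -> c * u 0 j = (u *m D *m M) 0 j + 1.
  move=> Pj; have uDMD : (u *m (D *m M *m D)) 0 j = (u *m D *m M) 0 j.
    by rewrite !mulmxA fDE Pj mulr1.
  have /rowP/(_ j) := uN; rewrite mulmxBr mul_mx_scalar [RHS]mxE => <-; rewrite addrC.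
  by rewrite [X in X + _]mxE [X in _ + X + _]mxE uDMD [X in X - _ + _]mxE subrK.
have uDM_ge0 j : 0 <= (u *m D *m M) 0 j.
  by rewrite mxE sumr_ge0 // => i _; rewrite fDE !mulr_ge0.
exists (u *m D); split=> [j|j Pj|j Pj]; rewrite fDE ?Pj ?mulr1 ?mulr_ge0 //.
  by rewrite -(pmulr_rgt0 _ c0) uE // ltr_wpDl.
by rewrite uE // lerDl.
Qed.

End PositiveSupersolution.

Lemma sum_ord_shift (V : nmodType) (n m i : nat) (F : nat -> V) :
  (i + m <= n)%N ->
  \sum_(t < m) F t = \sum_(j < n | (i <= j < i + m)%N) F (j - i)%N.
Proof.
move=> imn; under [RHS]eq_bigl do rewrite andbC.
rewrite -(big_geq_mkord _ _ (fun j => j < i + m)%N (fun j => F (j - i)%N)).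
rewrite -(big_nat_widen _ _ _ xpredT) // -{1}(add0n i) big_addn addKn big_mkord.
by apply: eq_bigr => t _; rewrite addnK.
Qed.

Lemma sum_sqrt_rev_le (R : rcfType) n (q : nat -> R) :
  (forall i, (i <= n)%N -> 0 <= q i) ->
  \sum_(i < n.+1) Num.sqrt (q i * q (n - i)%N) <= \sum_(i < n.+1) q i.
Proof.
move=> q0; have sum_rev : \sum_(i < n.+1) q (n - i)%N = \sum_(i < n.+1) q i.
  by rewrite [RHS](reindex_inj rev_ord_inj) /=; apply: eq_bigr => i _; rewrite subSS.
suff : \sum_(i < n.+1) 2 * Num.sqrt (q i * q (n - i)%N)
    <= \sum_(i < n.+1) (q i + q (n - i)%N).
  by rewrite -mulr_sumr big_split /= sum_rev; lra.
apply: ler_sum => i _.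
have q_ge0 : 0 <= q i by rewrite q0 // -ltnS.
have q_rev_ge0 : 0 <= q (n - i)%N by rewrite q0 // leq_subr.
rewrite sqrtrM //; have := sqr_ge0 (Num.sqrt (q i) - Num.sqrt (q (n - i)%N)).
by rewrite sqrrB !sqr_sqrtr //; lra.
Qed.

(* For [t < M], the levels [t + i] and [t + (r - i)] are exchanged by the steps
   numbered [i] and [r - i]; the guard keeps exactly these pairs. *)
Lemma toeplitz_supersolution_ge (R : rcfType) (D phi : nat -> R) (r M : nat) (c : R) :
  (forall i, 0 <= D i) -> (forall j, (j < M + r)%N -> 0 < phi j) ->
  (forall j, (j < M + r)%N ->
     \sum_(i < r.+1 | (i <= j < i + M)%N) D (r - i)%N * phi (j - i + (r - i))%N
       <= c * phi j) ->
  M%:R * \sum_(i < r.+1) Num.sqrt (D i * D (r - i)%N) <= (M + r)%:R * c.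
Proof.
move=> D0 phi0 supersol.
pose ratio (i t : nat) := D (r - i)%N * phi (t + (r - i))%N / phi (t + i)%N.
have level_le (t : 'I_M) :
    \sum_(i < r.+1) Num.sqrt (D i * D (r - i)%N) <= \sum_(i < r.+1) ratio i t.
  have pos i : (i <= r)%N -> 0 < phi (t + i)%N.
    by move=> ir; rewrite phi0 // -addSn leq_add.
  have ratio_ge0 i : (i <= r)%N -> 0 <= ratio i t.
    by move=> ir; rewrite divr_ge0 ?mulr_ge0 // ltW ?pos ?leq_subr.
  have ratio_rev (i : 'I_r.+1) : D i * D (r - i)%N = ratio i t * ratio (r - i)%N t.
    have ir : (i <= r)%N by rewrite -ltnS.
    by rewrite /ratio subKn //; field; rewrite !gt_eqF ?pos ?leq_subr.
  by under eq_bigr do rewrite ratio_rev; apply: (sum_sqrt_rev_le ratio_ge0).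
rewrite mulr_natl -[X in _ *+ X]card_ord -sumr_const.
apply: le_trans (ler_sum _ (fun t _ => level_le t)) _.
have shift_range (i : 'I_r.+1) : (i + M <= M + r)%N by rewrite addnC leq_add2l -ltnS.
rewrite exchange_big /=.
rewrite (eq_bigr _ (fun i _ => sum_ord_shift (ratio (val i)) (shift_range i))).
rewrite (exchange_big_dep xpredT) //= mulr_natl -[X in _ *+ X]card_ord -sumr_const.
apply: ler_sum => j _; rewrite -(ler_pM2r (phi0 _ (ltn_ord j))) mulr_suml.
apply: le_trans (supersol _ (ltn_ord j)); apply: ler_sum => i /andP[ij _].
by rewrite /ratio subnK // divfK ?gt_eqF ?phi0.
Qed.

Section Distance.
Variables (T : finType) (adj : rel T).
Hypotheses (simple : simple_graph adj) (conn : connected_graph adj).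
Local Open Scope nat_scope.
Local Notation d := (dist adj).

Lemma ballP k x y : reflect
  (exists p, [/\ path adj x p, last x p = y & size p <= k]) (y \in ball adj k x).
Proof.
elim: k y => [|k IH] y /=.
  rewrite inE; apply: (iffP eqP) => [->|[[|a p] [_ <-]] //]; by exists [::].
rewrite !inE; apply: (iffP orP) => [[/IH[p [pp lp sp]]|]|].
- by exists p; rewrite pp lp leqW.
- case/existsP=> u /andP[/IH[p [pp lp sp]] uy]; exists (rcons p y).
  by rewrite rcons_path pp lp uy last_rcons size_rcons.
case=> p [pp lp]; rewrite leq_eqVlt => /orP[/eqP sp|sp]; last first.
  by left; apply/IH; exists p; rewrite pp lp.
right; case/lastP: p pp lp sp => [//|p z].
rewrite rcons_path last_rcons size_rcons => /andP[pp az] zy [sp].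
apply/existsP; exists (last x p); rewrite -zy az andbT.
by apply/IH; exists p; rewrite pp sp.
Qed.

Lemma leq_dist k x y : (d x y <= k) = (y \in ball adj k x).
Proof.
have hasE : has (fun k => y \in ball adj k x) (iota 0 #|T|).
  have [j /ballP[p [pp lp _]]] := conn x y.
  case/shortenP: pp lp => q qq uq _ lq; apply/hasP; exists (size q).
    rewrite mem_iota add0n /=; have := card_uniqP uq => /= <-; exact: max_card.
  by apply/ballP; exists q; split=> //.
have lt_dist : d x y < #|T| by rewrite -[X in _ < X](size_iota 0) -has_find.
apply/idP/idP => [le_k|].
  have := nth_find 0 hasE; rewrite nth_iota // add0n => /ballP[p [pp lp sp]].
  by apply/ballP; exists p; split=> //; apply: leq_trans le_k.
move=> yk; rewrite leqNgt; apply/negP => lt_k.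
have := before_find 0 lt_k; rewrite nth_iota ?add0n ?yk //.
exact: ltn_trans lt_dist.
Qed.

Lemma dist_pathP k x y : reflect
  (exists p, [/\ path adj x p, last x p = y & size p <= k]) (d x y <= k).
Proof. by rewrite leq_dist; apply: ballP. Qed.

Lemma distxx x : d x x = 0.
Proof. by apply/eqP; rewrite -leqn0 leq_dist inE. Qed.

Lemma dist_adj x y : adj x y -> d x y <= 1.
Proof. by move=> xy; apply/dist_pathP; exists [:: y]; rewrite /= xy. Qed.

Lemma dist_sym x y : d x y = d y x.
Proof.
suff dist_rev z t : d z t <= d t z by apply/eqP; rewrite eqn_leq !dist_rev.
have /dist_pathP[p [pp <- sp]] := leqnn (d t z).
apply/dist_pathP; exists (rev (belast t p)); rewrite size_rev size_belast sp rev_path.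
split=> //; first by rewrite (eq_path (e' := adj)) // => a b /=; rewrite simple.1.
by case: p {pp sp} => //= a p; rewrite rev_cons last_rcons.
Qed.

Lemma dist_triangle y x z : d x z <= d x y + d y z.
Proof.
have /dist_pathP[p [pp lp sp]] := leqnn (d x y).
have /dist_pathP[q [pq lq sq]] := leqnn (d y z).
by apply/dist_pathP; exists (p ++ q); rewrite cat_path last_cat lp pp size_cat leq_add.
Qed.

Definition walk (x : nat -> T) : Prop := forall i, adj (x i) (x i.+1).

Lemma dist_walk x i j : walk x -> i <= j -> d (x i) (x j) <= j - i.
Proof.
move=> adjx /subnKC <-; rewrite addKn; elim: (j - i) => [|k IHk].
  by rewrite addn0 distxx.
apply: leq_trans (dist_triangle (x (i + k)) _ _) _.
by rewrite -[k.+1]addn1 leq_add // addnA addn1 dist_adj.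
Qed.

Lemma closer_neighbor o v : v != o -> exists2 u, adj v u & d o u < d o v.
Proof.
move=> vo; have /dist_pathP[[|u p] [/= pp lp sp]] := leqnn (d v o).
  by rewrite lp eqxx in vo.
case/andP: pp => vu pu; exists u => //; rewrite !(dist_sym o).
by apply: leq_trans sp; rewrite ltnS; apply/dist_pathP; exists p.
Qed.

(* The base point itself has no neighbour closer to it, hence the maximum. *)
Lemma homing_neighbor o w v : w != o ->
  exists2 u, adj v u & d o u <= maxn 1 (d o v).-1.
Proof.
move=> wo; have [->|/closer_neighbor[u vu ou]] := eqVneq v o; last first.
  by exists u => //; rewrite leq_max orbC -ltnS prednK ?ou // (leq_trans _ ou).
have [u ou _] : exists2 u, adj o u & d w u < d w o.
  by apply: closer_neighbor; rewrite eq_sym.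
by exists u; rewrite // leq_max dist_adj.
Qed.

Lemma homing_walk o w v : w != o ->
  exists x : nat -> T, [/\ x 0 = v, walk x & forall i, d o (x i) <= maxn 1 (d o v - i)].
Proof.
move=> wo; have /fin_all_exists2[h adjh dh] := fun v => homing_neighbor v wo.
exists (fun i => iter i h v); split=> //.
elim=> [|i /= IHi]; first by rewrite subn0 leq_maxr.
by apply: leq_trans (dh _) _; lia.
Qed.

Lemma delta_i_le x y i : adj x y ->
  delta_i adj i <= #|[set v | (d x v == i) && (i <= d y v)]|.
Proof.
move=> xy; rewrite /delta_i -minEnat -leEnat.
exact: (@bigmin_inf _ _ _ _ (x, y)).
Qed.

Definition branch (r : nat) (x : nat -> T) (i : nat) : {set T} :=
  [set v | (d (x i) v == r - i) && (r - i <= d (x i.+1) v)].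

(* Along a walk [d (x j) v + j] is nondecreasing; on the [i]-th branch it equals
   [r] at [i] and exceeds [r] at [i.+1]. *)
Lemma branch_inj r x v i j :
  walk x -> i <= r -> j <= r -> v \in branch r x i -> v \in branch r x j -> i = j.
Proof.
move=> adjx; wlog lt_ij : i j / i < j => [wl|].
  by case: (ltngtP i j) => // ij ir jr vi vj; [|symmetry]; apply: wl.
move=> ir jr; rewrite !inE => /andP[_ vi] /andP[/eqP vj _].
have := dist_triangle (x j) (x i.+1) v; have := dist_walk adjx lt_ij; lia.
Qed.

Lemma branch_ball r x v i :
  walk x -> i <= r -> v \in branch r x i -> d (x 0) v <= r.
Proof.
move=> adjx ir; rewrite inE => /andP[/eqP vi _].
have := dist_triangle (x i) (x 0) v; have := dist_walk adjx (leq0n i); lia.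
Qed.

Lemma diam_attained : 0 < diam adj -> exists x y, d x y = diam adj.
Proof.
rewrite /diam; have [T0|T0 _] := posnP #|T|.
  by rewrite big_pred0 // => x; have := card0_eq T0 x.
have [x ->] := bigop.eq_bigmax (fun x => \max_y d x y) T0.
by have [y ->] := bigop.eq_bigmax (d x) T0; exists x, y.
Qed.

End Distance.

Section DistancePower.
Variables (R : realType) (T : finType) (adj : rel T) (r : nat).
Hypotheses (simple : simple_graph adj) (conn : connected_graph adj).
Local Notation d := (dist adj).
Local Notation delta i := ((delta_i adj i)%:R : R).
Local Notation A := (distpow_mx R adj r).

Definition delta_sum : R := \sum_(i < r.+1) Num.sqrt (delta i * delta (r - i)).

Lemma delta_sum_ge0 : 0 <= delta_sum.
Proof. by apply: sumr_ge0 => i _; apply: sqrtr_ge0. Qed.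

Lemma hat_d_delta_sum :
  (0 < r)%N -> (r.+1)%:R * powR (hat_d R adj r) (r%:R / 2) = delta_sum.
Proof.
move=> r0; rewrite /hat_d -powRrM.
rewrite (_ : 2 / r%:R * (r%:R / 2) = 1); last by field; rewrite pnatr_eq0 -lt0n.
by rewrite big_mkord powRr1 ?mulr_ge0 ?invr_ge0 ?delta_sum_ge0 // mulVKf ?pnatr_eq0.
Qed.

Lemma sum_branches_le (x : nat -> T) (G : T -> R) (W : nat -> R) :
  walk adj x -> (forall u, 0 <= G u) -> (forall i, 0 <= W i) ->
  (forall i u, (i <= r)%N -> (d (x i) u <= r - i)%N -> W i <= G u) ->
  \sum_(i < r.+1) delta (r - i) * W i <= \sum_(u | (d (x 0) u <= r)%N) G u.
Proof.
move=> adjx G0 W0 WG.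
have le_r (i : 'I_r.+1) : (i <= r)%N by rewrite -ltnS.
have branch_le (i : 'I_r.+1) :
    delta (r - i) * W i <= \sum_u (u \in branch adj r x i)%:R * G u.
  apply: (@le_trans _ _ (#|branch adj r x i|%:R * W i)).
    by rewrite ler_wpM2r // ler_nat delta_i_le.
  rewrite mulr_natl -sumr_const big_mkcond; apply: ler_sum => u _.
  case: ifP => [|_]; last by rewrite mul0r.
  by rewrite mul1r inE => /andP[/eqP xu _]; rewrite WG ?xu.
apply: le_trans (ler_sum _ (fun i _ => branch_le i)) _.
rewrite exchange_big [leRHS]big_mkcond /=; apply: ler_sum => u _; rewrite -mulr_suml.
have [i ui|nou] := pickP (fun i : 'I_r.+1 => u \in branch adj r x i); last first.
  by rewrite big1 ?mul0r => [|i _]; [case: ifP|rewrite nou].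
rewrite (branch_ball conn adjx (le_r i) ui) (bigD1 i) //= ui big1 ?addr0 ?mul1r // => j.
apply: contraNeq; rewrite pnatr_eq0 eqb0 negbK => uj; apply/eqP/val_inj.
exact: (branch_inj conn adjx (le_r j) (le_r i) uj ui).
Qed.

Lemma ball_supersolution_ge (o w : T) (M : nat) (c : R) (G : T -> R) :
  w != o -> (forall u, 0 <= G u) ->
  (forall u, (d o u <= 2 * r + M)%N -> 0 < G u) ->
  (forall v, (d o v <= 2 * r + M)%N -> \sum_(u | (d v u <= r)%N) G u <= c * G v) ->
  M%:R * delta_sum <= (M + r)%:R * c.
Proof.
move=> wo G0 Gpos Gsup.
pose inball j u := (d o u <= r.+1 + j)%N.
pose xmin j := [arg min_(v < o | inball j v) G v]%O; pose phi j := G (xmin j).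
have xminP j : inball j (xmin j) /\ forall u, inball j u -> phi j <= G u.
  by rewrite /phi /xmin; case: arg_minP => //; rewrite /inball distxx.
have in_range j u : (j < M + r)%N -> inball j u -> (d o u <= 2 * r + M)%N.
  by move=> jM ou; apply: leq_trans ou _; lia.
apply: (toeplitz_supersolution_ge (D := fun i => delta i) (phi := phi)) => // j jM.
  exact/Gpos/(in_range _ _ jM)/(xminP j).1.
have [x [x0 adjx ox]] := homing_walk simple conn (xmin j) wo.
apply: le_trans (Gsup _ (in_range _ _ jM (xminP j).1)).
pose W i := if (i <= j < i + M)%N then phi (j - i + (r - i))%N else 0.
rewrite big_mkcond -x0 /=; apply: le_trans (sum_branches_le (W := W) adjx G0 _ _).
- by apply: ler_sum => i _; rewrite /W; case: ifP; rewrite ?mulr0.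
- by move=> i; rewrite /W; case: ifP => // _; apply: G0.
move=> i u ir xu; rewrite /W; case: ifP => // /andP[ij _]; apply: (xminP _).2.
have := dist_triangle conn (x i) o u; have := ox i; have := (xminP j).1.
by rewrite /inball; lia.
Qed.

Lemma mul_row_distpow_mx (u : 'rV[R]_#|T|) v :
  (u *m A) 0 (enum_rank v) = \sum_(w | (d v w <= r)%N) u 0 (enum_rank w).
Proof.
rewrite mxE [RHS]big_mkcond [RHS](reindex (@enum_val T T)) /=; last first.
  exact/onW_bij/enum_val_bij.
apply: eq_bigr => i _; rewrite !mxE enum_valK enum_rankK dist_sym //.
by case: ifP; rewrite ?mulr1 ?mulr0.
Qed.

Lemma ball_rayleigh_ge (o w : T) (M : nat) (c : R) :
  w != o -> 0 < c -> (M + r)%:R * c < M%:R * delta_sum ->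
  exists2 f : 'rV[R]_#|T|, forall j, f 0 j != 0 -> (d o (enum_val j) <= 2 * r + M)%N
    & rayleigh_ge A c f.
Proof.
move=> wo c0; apply: contraPP => noray; apply/negP; rewrite -leNgt.
pose P (j : 'I_#|T|) := (d o (enum_val j) <= 2 * r + M)%N.
have A0 i j : 0 <= A i j by rewrite mxE.
have noray_ball (f : 'rV_#|T|) : (forall j, f 0 j != 0 -> P j) -> ~~ rayleigh_ge A c f.
  by move=> suppf; apply/negP => ray; apply: noray; exists f.
have [u [u0 upos uA]] := positive_supersolution c0 A0 noray_ball.
apply: (@ball_supersolution_ge o w M c (fun v => u 0 (enum_rank v)) wo) => // v ov.
  by apply: upos; rewrite /P enum_rankK.
by rewrite -mul_row_distpow_mx uA // /P enum_rankK.
Qed.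

Lemma distpow_mx_sym : A^T = A.
Proof. by apply/matrixP=> i j; rewrite !mxE dist_sym. Qed.

Lemma lambda2_distpow_ge0 (x y : T) l : x != y -> is_lambda2 A l -> 0 <= l.
Proof.
move=> xy lA; apply: (lambda2_ge0 (i := enum_rank x) (j := enum_rank y)) lA _ _ _.
- exact: distpow_mx_sym.
- by rewrite (inj_eq enum_rank_inj).
- by rewrite !mxE !distxx.
by rewrite !mxE distxx //= normr_nat ler_nat leq_b1.
Qed.

Lemma lambda2_distpow_ge (x y : T) (M : nat) l :
  (5 * r + 2 * M < d x y)%N -> is_lambda2 A l -> M%:R * delta_sum <= (M + r)%:R * l.
Proof.
move=> far lA; have xy : x != y by apply: contraTneq far => ->; rewrite distxx.
have l0 := lambda2_distpow_ge0 xy lA.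
rewrite leNgt; apply/negP => lt_l.
have M_gt0 : 0 < (M + r)%:R :> R.
  rewrite ltr0n addn_gt0; case: posnP lt_l => [->|//].
  by rewrite mul0r ltNge mulr_ge0.
have [c lc c_lt] : exists2 c, l < c & (M + r)%:R * c < M%:R * delta_sum.
  move: lt_l; rewrite mulrC -ltr_pdivlMr // => /midf_lt[lc c_lt].
  by eexists; [exact: lc | rewrite mulrC -ltr_pdivlMr].
have c0 := le_lt_trans l0 lc; have yx : y != x by rewrite eq_sym.
have [f suppf ray_f] := ball_rayleigh_ge yx c0 c_lt.
have [g suppg ray_g] := ball_rayleigh_ge xy c0 c_lt.
have apart i j : f 0 i != 0 -> g 0 j != 0 -> (r < d (enum_val i) (enum_val j))%N.
  move=> /suppf fi /suppg gj; have := dist_triangle conn (enum_val i) x y.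
  have := dist_triangle conn (enum_val j) (enum_val i) y.
  rewrite (dist_sym simple conn (enum_val j) y); lia.
suff : c <= l by rewrite leNgt lc.
apply: (lambda2_ge_orthogonal_pair distpow_mx_sym lA _ _ ray_f ray_g).
  apply: form_eq0 => i j fi gj; rewrite mxE; case: eqP => // ij.
  by have := apart i j fi gj; rewrite ij distxx.
by apply: form_eq0 => i j fi gj; rewrite mxE leqNgt apart.
Qed.

Lemma lambda2_distpow_diam_ge (eps l : R) :
  (0 < r)%N -> r%:R = eps * (diam adj)%:R -> is_lambda2 A l ->
  (1 - 20 * eps) * delta_sum <= l.
Proof.
move=> r0 rE lA; have S0 := delta_sum_ge0.
have D0 : (0 < diam adj)%N.
  by rewrite lt0n; apply: contra_eqN rE => /eqP->; rewrite mulr0 pnatr_eq0 -lt0n.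
have [x [y xyD]] := diam_attained D0.
have xy : x != y by apply: contraTneq D0 => xy; rewrite -xyD xy distxx.
have l0 := lambda2_distpow_ge0 xy lA.
have [big|small] := leP 1 (20 * eps); first by nra.
have D0R : 0 < (diam adj)%:R :> R by rewrite ltr0n.
have rD : (20 * r < diam adj)%N by rewrite -(ltr_nat R) natrM rE; nra.
pose M := (diam adj %/ 4)%N; pose levels : R := (M + r)%:R.
have levels_gt0 : 0 < levels by rewrite ltr0n addn_gt0 r0 orbT.
have diam_le : (diam adj)%:R <= 4 * levels by rewrite -natrM ler_nat; lia.
have far : (5 * r + 2 * M < d x y)%N by rewrite xyD; lia.
have eps0 : 0 <= eps by rewrite -(pmulr_lge0 _ D0R) -rE.
have M_ge : (1 - 4 * eps) * levels <= M%:R.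
  have -> : M%:R = levels - r%:R :> R by rewrite /levels natrD addrK.
  by rewrite rE; nra.
suff : (1 - 4 * eps) * delta_sum <= l by nra.
rewrite -(ler_pM2l levels_gt0); apply: le_trans (lambda2_distpow_ge far lA).
by rewrite mulrCA mulrA ler_wpM2r.
Qed.

End DistancePower.

Theorem theorem3 (R : realType) :
  exists c : R -> R,
    (forall eta : R, 0 < eta -> exists delta : R, 0 < delta /\
        forall eps : R, 0 < eps -> eps < delta -> `|c eps| < eta) /\
    forall eps : R, 0 < eps ->
    forall (V : nat -> finType) (adj : forall n, rel (V n)),
      (forall n, simple_graph (adj n)) ->
      (forall n, connected_graph (adj n)) ->
      (forall M : nat, exists N : nat, forall n, (N <= n)%N -> (M <= diam (adj n))%N) ->
    forall r : nat -> nat,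
      (forall n, (0 < r n)%N) ->
      (forall n, (r n)%:R = eps * (diam (adj n))%:R :> R) ->
    forall eta : R, 0 < eta ->
    exists N : nat, forall n, (N <= n)%N ->
    forall l : R, is_lambda2 (distpow_mx R (adj n) (r n)) l ->
      (1 - c eps - eta) * ((r n).+1)%:R
        * powR (hat_d R (adj n) (r n)) ((r n)%:R / 2) <= l.
Proof.
exists (fun eps => 20 * eps); split=> [eta eta0|].
  exists (eta / 20); split=> [|eps eps0 lt]; first by rewrite divr_gt0.
  by rewrite ger0_norm ?mulr_ge0 ?ltW //; lra.
move=> eps _ V adj simple conn _ r r0 rE eta eta0; exists 0%N => n _ l lA.
rewrite -mulrA hat_d_delta_sum //.
apply: le_trans (lambda2_distpow_diam_ge (simple n) (conn n) (r0 n) (rE n) lA).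
by rewrite ler_wpM2r ?delta_sum_ge0 //; lra.
Qed.
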